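(* Let $\sigma$ be a simple permutation of length $n\ge 1$ which is not a parallel alternation. Then $\sigma$ contains an entry $x$ such that the permutation $\sigma-x$ of length $n-1$, obtained by removing $x$ from $\sigma$, is simple.
   Context: A permutation $\pi$ of length $n$ is a bijection of $\{1,\dots,n\}$, written in one-line notation $\pi(1)\pi(2)\cdots\pi(n)$ and identified with its plot, the set of points $(i,\pi(i))$ in the plane; these points are its entries. Removing an entry $x$ from $\pi$ leaves the permutation $\pi-x$ of length $n-1$ obtained by deleting $x$ and relabelling the remaining positions and values by $1,\dots,n-1$ in an order-preserving way. An interval in $\pi$ is a set of entries occupying contiguous positions whose values also form a contiguous set of integers (the empty set counts as an interval). Intervals of lengths (i.e., numbers of entries) $0$, $1$, and $n$ are called trivial. A permutation is simple if its only intervals are trivial. For example, $1$, $12$, $21$ are simple (and the empty permutation is, vacuously, simple), no permutation of length three is simple, and the simple permutations of length four are exactly $2413$ and $3142$. A parallel alternation is a permutation whose entries can be divided into two halves of equal length, either both increasing or both decreasing, such that the entries of the halves interleave perfectly. Precisely, a permutation of length $n=2m$ with $m\ge 1$ is a parallel alternation if at least one of the following holds: (i) (halves separated by a horizontal line) letting the halves be the set of $m$ entries of smallest value and the set of $m$ entries of largest value, the two halves, read from left to right, are both increasing or both decreasing, and as one reads the positions from left to right the entries alternate between the two halves (starting with either half); (ii) (halves separated by a vertical line) letting the halves be the first $m$ entries and the last $m$ entries by position, the two halves, read from left to right, are both increasing or both decreasing, and as one reads the values from bottom to top the entries alternate between the two halves (starting with either half). For example, $12$, $21$, $2413$, $3142$,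 $1324$, $51627384$ and $75318642$ are parallel alternations. *)

(* Defs.v *)
From mathcomp Require Import all_boot all_fingroup.

Set Implicit Arguments.
Unset Strict Implicit.
Unset Printing Implicit Defensive.

(* A permutation of length n is an element of 'S_n: positions and values range
   over {0, ..., n-1} instead of {1, ..., n}. The entry (i, s i) is represented
   by its position i, so sets of entries of s are sets of positions. *)

Section Permutations.

Variable n : nat.
Implicit Types (s : 'S_n) (A B : {set 'I_n}) (x : 'I_n).

(* [lift x] is the increasing bijection from {0, ..., n-2} onto the ordinals
   different from x, and [unlift (s x)] is the order-preserving relabelling of
   the values different from s x; see lift_perm_del. *)
Definition perm_del_fun s x (k : 'I_n.-1) : 'I_n.-1 :=
  odflt k (unlift (s x) (s (lift x k))).

Lemma lift_perm_del_fun s x k : lift (s x) (perm_del_fun s x k) = s (lift x k).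
Proof.
rewrite /perm_del_fun; case: unliftP => [j -> //|/perm_inj /eqP].
by rewrite eq_sym (negPf (neq_lift x k)).
Qed.

Lemma perm_del_fun_inj s x : injective (perm_del_fun s x).
Proof.
move=> k l eq_kl; apply/(@lift_inj _ x)/(@perm_inj _ s).
by rewrite -!lift_perm_del_fun eq_kl.
Qed.

Definition perm_del s x : 'S_n.-1 := perm (@perm_del_fun_inj s x).

Lemma lift_perm_del s x k : lift (s x) (perm_del s x k) = s (lift x k).
Proof. by rewrite permE lift_perm_del_fun. Qed.

Definition contiguous A : Prop :=
  forall i j k : 'I_n, i \in A -> j \in A -> i <= k <= j -> k \in A.

Definition perm_interval s A : Prop := contiguous A /\ contiguous (s @: A).

Definition simple_perm s : Prop :=
  forall A, perm_interval s A -> [\/ #|A| = 0, #|A| = 1 | #|A| = n].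

Definition increasing_on s A : Prop :=
  forall i j : 'I_n, i \in A -> j \in A -> i < j -> s i < s j.

Definition decreasing_on s A : Prop :=
  forall i j : 'I_n, i \in A -> j \in A -> i < j -> s j < s i.

Definition both_monotone s A B : Prop :=
  (increasing_on s A /\ increasing_on s B) \/
  (decreasing_on s A /\ decreasing_on s B).

(* Read in increasing order, the elements of 'I_n alternate between A and B. *)
Definition alternate A B : Prop :=
  forall i j : 'I_n, j = i.+1 :> nat ->
    (i \in A /\ j \in B) \/ (i \in B /\ j \in A).

Definition horizontal_parallel_alternation s (m : nat) : Prop :=
  let low := [set i | s i < m] in
  let high := [set i | m <= s i] in
  both_monotone s low high /\ alternate low high.

(* The images s @: left and s @: right are the sets of values of the halves. *)
Definition vertical_parallel_alternation s (m : nat) : Prop :=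
  let left := [set i : 'I_n | i < m] in
  let right := [set i : 'I_n | m <= i] in
  both_monotone s left right /\ alternate (s @: left) (s @: right).

Definition parallel_alternation s : Prop :=
  exists m : nat, [/\ 0 < m, n = 2 * m &
    horizontal_parallel_alternation s m \/ vertical_parallel_alternation s m].

End Permutations.

(* Main.v *)
Require Import Defs.
From mathcomp Require Import all_boot all_fingroup zify.

Set Implicit Arguments.
Unset Strict Implicit.
Unset Printing Implicit Defensive.

(** Entries of a permutation are compared by a colour: the colour of the ordered
pair (a, b) is the quadrant around a that contains b. A set is an interval
exactly when no entry outside it sees two of its entries in different colours,
so simplicity depends on the colouring alone, and most of the argument uses
only a colouring in which the colour of (b, a) is determined by that of (a, b).

Suppose that a simple permutation of length n has no simple one-point deletion;
the aim is to show that it is a parallel alternation. The lengths n <= 2 are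
trivial. If n > 2, then the permutation contains a simple pattern of length 4
([exists_zigzag4]), and a simple set X with 2 < #|X| <= n - 2 can always be
enlarged by two entries to a simple set ([stuck_card]). Hence there are simple
sets of every even size from 4 to n. If n were odd, then one of them would have
size n - 1, against the assumption; so n is even and, when n > 4, some
complement of a pair is simple. Call x and y adjacent when the complement of
{x, y} is simple.

Adjacency is very rigid. If x and y are adjacent, then the complement of {x, y}
is a simple set X, and adding y to it gives the non-simple deletion of x;
therefore either y is in a corner of that deletion, or y and another entry z are
twins, that is, form an interval of length two there. In the second case z can
replace y, so z is adjacent to x as well. It follows that an entry has at most
two neighbours ([adj_three]), that two neighbours of x are twins once x is
removed ([adj_twin]), and that the neighbour of an entry of degree one is in a
corner once that entry is removed ([adj_or]). In a longest path x_0, x_1, ... of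
adjacent entries, x_i and x_(i+2) are therefore told apart by x_(i+1) only, and
equality of colours propagates along indices of equal parity ([path_run]).
Propagation shows that the path does not close up into a cycle
([path_not_cycle]), that it contains every entry ([path_cover]), and that for
i < j the colour of (x_i, x_j) is one constant e when i is even and j is odd,
and another constant c otherwise ([path_colors]). Since e is neither c nor the
opposite quadrant, exactly one of the two coordinates is monotone along the
path, while the other reverses its direction on the pairs with i even and j odd:
this is a parallel alternation, horizontal if the positions are monotone and
vertical if the values are. *)

(** * Modules, corners and twins of a colouring *)

Section Definitions.

Variables (T : finType) (C : eqType) (col : T -> T -> C).
Implicit Types (S A : {set T}) (a b u v w : T).

Definition module_of S A :=
  [forall w in S :\: A, forall a in A, forall b in A, col w a == col w b].

Definition simple_on S :=
  [forall A : {set T}, (A \subset S) && module_of S A ==> (#|A| <= 1) || (A == S)].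

(** For permutations: v is extreme in both coordinates among the entries of S,
so that the other entries of S form an interval of S. *)
Definition corner S v :=
  [forall a in S, forall b in S, (a != v) && (b != v) ==> (col v a == col v b)].

Definition twin S u v :=
  [forall w in S, (w != u) && (w != v) ==> (col w u == col w v)].

Lemma module_ofP S A :
  reflect (forall w a b, w \in S -> w \notin A -> a \in A -> b \in A ->
             col w a = col w b)
          (module_of S A).
Proof.
apply: (iffP forall_inP) => [mA w a b wS wA aA bA|mA w].
  have /mA/forall_inP/(_ a aA)/forall_inP/(_ b bA)/eqP // : w \in S :\: A.
  by rewrite inE wA.
rewrite inE => /andP[wA wS]; apply/forall_inP=> a aA; apply/forall_inP=> b bA.
by rewrite (mA w a b).
Qed.

Lemma simple_onP S :
  reflect (forall A, A \subset S -> module_of S A -> #|A| <= 1 \/ A = S)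
          (simple_on S).
Proof.
apply: (iffP forallP) => [sS A AS mA|sS A].
  have := sS A; rewrite AS mA /= => /orP[|/eqP]; by [left|right].
apply/implyP=> /andP[AS mA]; apply/orP.
by case: (sS A AS mA) => [|/eqP]; [left|right].
Qed.

Lemma cornerP S v :
  reflect (forall a b, a \in S -> b \in S -> a != v -> b != v -> col v a = col v b)
          (corner S v).
Proof.
apply: (iffP forall_inP) => [cv a b aS bS av bv|cv a aS].
  by have /forall_inP/(_ b bS) := cv a aS; rewrite av bv => /eqP.
by apply/forall_inP=> b bS; apply/implyP=> /andP[av bv]; rewrite (cv a b).
Qed.

Lemma twinP S u v :
  reflect (forall w, w \in S -> w != u -> w != v -> col w u = col w v)
          (twin S u v).
Proof.
apply: (iffP forall_inP) => [tw w wS wu wv|tw w wS].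
  by have := tw w wS; rewrite wu wv => /eqP.
by apply/implyP=> /andP[wu wv]; rewrite tw.
Qed.

End Definitions.

(** Simplicity depends only on the colours of pairs of distinct elements, so it can
be pulled back along an injection that preserves them. *)
Lemma simple_transfer (T T' : finType) (C : eqType) (col : T -> T -> C)
    (col' : T' -> T' -> C) (f : T -> T') (S : {set T}) :
    injective f ->
    {in S &, forall a b, a != b -> col' (f a) (f b) = col a b} ->
  simple_on col' (f @: S) -> simple_on col S.
Proof.
move=> f_inj fcol /simple_onP sS; apply/simple_onP=> A AS /module_ofP mA.
have AS' := subsetP AS; case: (sS (f @: A)); first exact: imsetS.
- apply/module_ofP=> _ _ _ /imsetP[w wS ->] wA /imsetP[a aA ->] /imsetP[b bA ->].
  rewrite mem_imset // in wA.
  have wn z : z \in A -> w != z by move=> zA; apply: contraNneq wA => ->.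
  by rewrite !fcol ?wn //; [apply: mA|apply: AS'|apply: AS'].
- by rewrite card_imset //; left.
- by move/(imset_inj f_inj); right.
Qed.

Section Structure.

Variables (T : finType) (C : eqType) (col : T -> T -> C) (inv : C -> C).
Hypothesis colC : forall a b, a != b -> col b a = inv (col a b).
Implicit Types (S A X : {set T}) (a b u v w x y z t : T).

Local Notation module_of := (module_of col).
Local Notation simple_on := (simple_on col).
Local Notation corner := (corner col).
Local Notation twin := (twin col).

Lemma twinC S u v : twin S u v = twin S v u.
Proof. by apply/twinP/twinP=> tw w wS wu wv; rewrite tw. Qed.

Lemma col_flip w a b : w != a -> w != b -> col w a = col w b -> col a w = col b w.
Proof. by move=> wa wb e; rewrite (colC wa) (colC wb) e. Qed.

Lemma col_flipr w a b : w != a -> w != b -> col a w = col b w -> col w a = col w b.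
Proof. by rewrite ![w == _]eq_sym => aw bw e; rewrite (colC aw) (colC bw) e. Qed.

Lemma not_simpleP S : ~~ simple_on S ->
  exists A, [/\ A \subset S, module_of S A, 1 < #|A| & A != S].
Proof.
case/forallPn=> A; rewrite negb_imply negb_or -ltnNge => /andP[/andP[AS mA] /andP[A1 AnS]].
by exists A.
Qed.

Lemma twin_not_simple S u v : u \in S -> v \in S -> u != v -> 2 < #|S| ->
  twin S u v -> ~~ simple_on S.
Proof.
move=> uS vS uv S3 /twinP tw; apply/negP => /simple_onP sS.
have sub : [set u; v] \subset S by apply/subsetP=> w /set2P[] ->.
case: (sS _ sub); last by move=> e; move: S3; rewrite -e cards2; case: (u != v).
  apply/module_ofP=> w a b wS; rewrite !inE negb_or => /andP[wu wv].
  by move=> /orP[]/eqP-> /orP[]/eqP->; rewrite ?tw.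
by rewrite cards2 uv.
Qed.

Lemma corner_not_simple S v : v \in S -> 2 < #|S| -> corner S v -> ~~ simple_on S.
Proof.
move=> vS S3 /cornerP cv; apply/negP => /simple_onP sS.
have cS : #|S :\ v| = #|S|.-1 by rewrite [in RHS](cardsD1 v S) vS.
case: (sS (S :\ v)); rewrite ?subD1set //; last 2 first.
- by rewrite cS; lia.
- by move/setP/(_ v); rewrite !inE eqxx vS.
apply/module_ofP=> w a b wS; rewrite !inE wS andbT negbK => /eqP->.
by move=> /andP[av aS] /andP[bv bS]; apply: cv.
Qed.

Lemma subset_twin S S' u v : S' \subset S -> twin S u v -> twin S' u v.
Proof. by move=> /subsetP sub /twinP tw; apply/twinP=> w /sub; apply: tw. Qed.

(** The trace of a module on a simple subset is a module of that subset. *)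
Lemma module_trace X S A : simple_on X -> X \subset S -> module_of S A ->
  [\/ A :&: X = set0, exists2 t, t \in X & A :&: X = [set t] | X \subset A].
Proof.
move=> /simple_onP sX /subsetP XS /module_ofP mA.
case: (sX (A :&: X)); first exact: subsetIr.
- apply/module_ofP=> w a b wX; rewrite !inE wX andbT => wA /andP[aA _] /andP[bA _].
  by apply: mA => //; apply: XS.
- case: (posnP #|A :&: X|) => [/eqP|pos le1]; first by rewrite cards_eq0 => /eqP; constructor 1.
  have /cards1P[t At] : #|A :&: X| == 1 by lia.
  by constructor 2; exists t => //; have : t \in A :&: X; [rewrite At set11|case/setIP].
- by move=> <-; constructor 3; apply: subsetIl.
Qed.

(** * Extending a simple set by two elements *)

Section Outside.

Variable X : {set T}.
Hypotheses (sX : simple_on X) (X3 : 2 < #|X|).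

(** If v sees all of X alike and is a twin of u, then u sees the rest of X alike,
which makes the rest of X a nontrivial module of X. *)
Lemma corner_twinF u v : u \in X -> v \notin X ->
  corner X v -> twin X u v -> False.
Proof.
move=> uX vX /cornerP cv /twinP tw.
have : corner X u; last by move/(corner_not_simple uX X3); rewrite sX.
have out w : w \in X -> w != v by apply: contraTneq => ->.
apply/cornerP=> a b aX bX au bu.
rewrite (colC au) (colC bu) tw ?out // tw ?out // -!colC ?out //.
by apply: cv; rewrite ?out.
Qed.

Lemma twin_uniq u t v : u \in X -> t \in X -> v \notin X ->
  twin X u v -> twin X t v -> u = t.
Proof.
move=> uX tX vX /twinP twu /twinP twt; apply/eqP; apply: contraT => ut.
have : twin X u t; last by move/(twin_not_simple uX tX ut X3); rewrite sX.
apply/twinP=> w wX wu wt; rewrite twu ?twt //; by apply: contraNneq vX => <-.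
Qed.

(** A nontrivial module of X plus v meets X in a single element, which is then a
twin of v, or contains X, and then equals X because it is proper. *)
Lemma add_one v : v \notin X -> ~~ simple_on (v |: X) ->
  corner X v \/ exists2 u, u \in X & twin X u v.
Proof.
move=> vX /not_simpleP[A [AS mA A1 AnS]].
have inA w : w \in A -> w = v \/ w \in X by move/(subsetP AS)/setU1P.
have mA' := elimT (module_ofP _ _ _) mA.
have XS : X \subset v |: X by apply: subsetU1.
case: (module_trace sX XS mA) => [A0|[t tX At]|XA].
- move: A1; rewrite ltnNge -(cards1 v) subset_leq_card //.
  apply/subsetP=> w wA; case: (inA w wA) => [->|wX]; first exact: set11.
  by have : w \in A :&: X; [rewrite inE wA|rewrite A0 !inE].
- right; exists t => //; have : t \in A :&: X by rewrite At set11.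
  case/setIP=> tA _; have vA : v \in A.
    apply: contraTT A1 => vA; rewrite -leqNgt -(cards1 t) subset_leq_card // -At.
    by apply/subsetP=> w wA; rewrite inE wA; case: (inA w wA) => // e; rewrite -e wA in vA.
  apply/twinP=> w wX wt wv; apply: mA' => //; first by rewrite inE wX orbT.
  by apply: contra wt => wA; rewrite -in_set1 -At inE wA.
- left; have vA : v \notin A.
    apply: contra AnS => vA; rewrite eqEsubset AS subUset XA andbT.
    by rewrite sub1set.
  apply/cornerP=> a b aX bX _ _; apply: mA' => //; rewrite ?setU11 //; exact: (subsetP XA).
Qed.

(** The cases are the possible traces on X of a nontrivial module of X plus v and w:
in the first the module is {v, w}; in the next two it has one element t of X
together with v, or with w but not v; in the last it contains X and misses at
least one of v and w. *)
Lemma add_two v w : v \notin X -> w \notin X -> v != w ->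
    ~~ simple_on (v |: (w |: X)) ->
  [\/ {in X, forall a, col a v = col a w},
      exists2 t, t \in X & twin X t v /\ (twin X t w \/ col w t = col w v),
      exists2 t, t \in X & twin X t w /\ col v t = col v w |
      [\/ corner X v /\ {in X, forall a, col v a = col v w},
          corner X w /\ {in X, forall a, col w a = col w v} |
          corner X v /\ corner X w]].
Proof.
move=> vX wX vw /not_simpleP[A [AS mA A1 AnS]].
have inA z : z \in A -> [\/ z = v, z = w | z \in X].
  by move/(subsetP AS); rewrite !inE => /or3P[/eqP|/eqP|]; by [constructor 1|constructor 2|constructor 3].
have mA' := elimT (module_ofP _ _ _) mA.
have XS : X \subset v |: (w |: X) by rewrite setUA subsetUr.
have vS : v \in v |: (w |: X) by rewrite !inE eqxx.
have wS : w \in v |: (w |: X) by rewrite !inE eqxx orbT.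
case: (module_trace sX XS mA) => [A0|[t tX At]|XA].
- have XA z : z \in X -> z \notin A.
    by move=> zX; apply/negP=> zA; have : z \in A :&: X; [rewrite inE zA|rewrite A0 !inE].
  constructor 1 => a aX; apply: mA'; rewrite ?(subsetP XS) ?XA //.
    apply: contraTT A1 => vA; rewrite -leqNgt -(cards1 w) subset_leq_card //.
    apply/subsetP=> z zA; rewrite inE; case: (inA z zA) => [e|->//|/XA]; last by rewrite zA.
    by rewrite -e zA in vA.
  apply: contraTT A1 => wA; rewrite -leqNgt -(cards1 v) subset_leq_card //.
  apply/subsetP=> z zA; rewrite inE; case: (inA z zA) => [->//|e|/XA]; last by rewrite zA.
  by rewrite -e zA in wA.
- have tA : t \in A by have : t \in A :&: X; [rewrite At set11|case/setIP].
  have tw z : z \in A -> twin X t z.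
    move=> zA; apply/twinP=> a aX at_ az; apply: mA'; rewrite ?(subsetP XS) //.
    by apply: contra at_ => aA; rewrite -in_set1 -At inE aA.
  have [vA|vA] := boolP (v \in A).
    constructor 2; exists t => //; split; first exact: tw.
    by have [wA|wA] := boolP (w \in A); [left; apply: tw|right; apply: mA'].
  have wA : w \in A.
    apply: contraTT A1 => wA; rewrite -leqNgt -(cards1 t) subset_leq_card // -At.
    apply/subsetP=> z zA; rewrite inE zA; case: (inA z zA) => // e.
      by rewrite -e zA in vA.
    by rewrite -e zA in wA.
  by constructor 3; exists t => //; split; [apply: tw|apply: mA'].
- have cA z : z \in v |: (w |: X) -> z \notin A -> corner X z.
    by move=> zS zA; apply/cornerP=> a b aX bX _ _; apply: mA' => //; apply: (subsetP XA).
  constructor 4; have [vA|vA] := boolP (v \in A); have [wA|wA] := boolP (w \in A).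
  + by case/eqP: AnS; apply/eqP; rewrite eqEsubset AS !subUset !sub1set vA wA.
  + by constructor 2; split=> [|a aX]; [apply: cA|apply: mA' => //; apply: (subsetP XA)].
  + by constructor 1; split=> [|a aX]; [apply: cA|apply: mA' => //; apply: (subsetP XA)].
  + by constructor 3; split; apply: cA.
Qed.

Lemma outside_neq z a : z \notin X -> a \in X -> a != z.
Proof. by move=> zX; apply: contraTneq => ->. Qed.

(** From here on, no two outside elements extend X to a simple set; this is
refuted as soon as at least two elements lie outside X. *)
Hypothesis sT : simple_on setT.
Hypothesis stuck : forall v w, v \notin X -> w \notin X -> v != w ->
  ~~ simple_on (v |: (w |: X)).

(** Every outside element that is a corner for X sees X and the outside elements
that are not corners alike, by the case analysis of [add_two]. So the elements
that are not such corners form a module of the whole simple structure. *)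
Lemma stuck_not_corner v : v \notin X -> ~~ corner X v.
Proof.
move=> vX; apply/negP=> cv; pose A := [set z | (z \in X) || ~~ corner X z].
have [x0 x0X] : exists x0, x0 \in X by apply/card_gt0P; lia.
case: (elimT (simple_onP _ _) sT A (subsetT A)).
- apply/module_ofP=> w; suff key a : w \notin A -> a \in A -> col w a = col w x0.
    by move=> a b _ wA aA bA; rewrite !key.
  rewrite !inE negb_or negbK => /andP[wX cw].
  have [aX _|aX /= ca] := boolP (a \in X).
    by apply: (elimT (cornerP _ _ _) cw); rewrite // outside_neq.
  have wa : w != a by apply: contraNneq ca => <-.
  case: (add_two wX aX wa (stuck wX aX wa)).
  + move=> tw; case/negP: ca; apply/cornerP=> b1 b2 b1X b2X _ _.
    have flip b : b \in X -> col a b = col w b.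
      by move=> bX; apply: col_flip; rewrite 1?tw // outside_neq.
    by rewrite !flip //; apply: (elimT (cornerP _ _ _) cw); rewrite // outside_neq.
  + by case=> t tX [tw _]; case: (corner_twinF tX wX cw tw).
  + case=> t tX [_ <-].
    by apply: (elimT (cornerP _ _ _) cw); rewrite // outside_neq.
  + by case=> [[_ /(_ x0 x0X)-> //]|[ca']|[_ ca']]; rewrite ca' in ca.
- have: X \subset A by apply/subsetP=> z zX; rewrite inE zX.
  by move/subset_leq_card; lia.
- by move/setP/(_ v); rewrite !inE cv (negPf vX).
Qed.

(** Likewise, u and its outside twins form a module of the whole structure. *)
Lemma stuck_not_twin u v : u \in X -> v \notin X -> ~~ twin X u v.
Proof.
move=> uX vX; apply/negP=> tuv; pose A := u |: [set z | (z \notin X) && twin X u z].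
case: (elimT (simple_onP _ _) sT A (subsetT A)).
- apply/module_ofP=> w; suff key a : w \notin A -> a \in A -> col w a = col w u.
    by move=> a b _ wA aA bA; rewrite !key.
  rewrite !inE !negb_or negb_and negbK => /andP[wu tw].
  case/orP=> [/eqP-> //|/andP[aX tua]].
  have [wX|wX] := boolP (w \in X).
    by rewrite (elimT (twinP _ _ _ _) tua) // outside_neq.
  rewrite (negPf wX) /= in tw.
  have aw : a != w by apply: contraNneq tw => <-.
  case: (add_two aX wX aw (stuck aX wX aw)).
  + move=> e; case/negP: tw; apply/twinP=> b bX bu bw.
    by rewrite -e //; apply: (elimT (twinP _ _ _ _) tua); rewrite // outside_neq.
  + case=> t tX [tta]; rewrite -(twin_uniq uX tX aX tua tta); case=> // ttw.
    by rewrite ttw in tw.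
  + case=> t tX [ttw ata].
    have ut : u != t by apply: contraNneq tw => ->.
    have tu : t != u by rewrite eq_sym.
    have au := outside_neq aX uX; have at_ := outside_neq aX tX.
    apply: col_flipr; rewrite // 1?eq_sym // -ata.
    rewrite -(elimT (twinP _ _ _ _) ttw u) //; last by rewrite eq_sym.
    apply: col_flip => //.
    by symmetry; apply: (elimT (twinP _ _ _ _) tua).
  + case=> [[ca _]|[_ /(_ u uX)-> //]|[ca _]]; by case: (corner_twinF uX aX ca tua).
- have : [set u; v] \subset A.
    by apply/subsetP=> z /set2P[]->; rewrite !inE ?eqxx // vX tuv orbT.
  by move/subset_leq_card; rewrite cards2 outside_neq //; lia.
- move=> AT; have : X \subset [set u].
    apply/subsetP=> z zX; have : z \in A by rewrite AT.
    by rewrite !inE zX orbF.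
  by move/subset_leq_card; rewrite cards1; lia.
Qed.

(** Since outside elements are neither corners nor twins, the only surviving case of
[add_two] says that X does not separate them: the complement of X is a module. *)
Lemma stuck_card : #|T| <= #|X|.+1.
Proof.
rewrite leqNgt; apply/negP=> XT.
have cX := cardsC X.
case: (elimT (simple_onP _ _) sT (~: X) (subsetT _)).
- apply/module_ofP=> a v w _; rewrite !inE negbK => aX vX wX.
  have [-> //|vw] := eqVneq v w.
  case: (add_two vX wX vw (stuck vX wX vw)) => [-> //|[t tX [ttv _]]|[t tX [ttw _]]|].
  + by case/negP: (stuck_not_twin tX vX).
  + by case/negP: (stuck_not_twin tX wX).
  + have /negP nv := stuck_not_corner vX; have /negP nw := stuck_not_corner wX.
    by case=> [[/nv]|[/nw]|[/nv]].
- by lia.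
- by move=> e; move: cX; rewrite e cardsT; lia.
Qed.

End Outside.

(** * Paths along which the element between two twins separates them *)

Section Path.

Variables (x : nat -> T) (k : nat).
Hypothesis x_inj : forall i j, i < k -> j < k -> x i = x j -> i = j.
Hypothesis x_twin : forall i, i.+2 < k -> twin [set~ x i.+1] (x i) (x i.+2).

Let P := [set x (val i) | i : 'I_k].

Lemma mem_path z : reflect (exists2 i, i < k & z = x i) (z \in P).
Proof.
apply: (iffP imsetP) => [[i _ ->]|[i ik ->]]; first by exists i.
by exists (Ordinal ik).
Qed.

Lemma card_path : #|P| = k.
Proof.
rewrite card_imset ?card_ord // => i j e; apply: val_inj.
exact: x_inj (ltn_ord i) (ltn_ord j) e.
Qed.

Lemma x_neq i j : i < k -> j < k -> i != j -> x i != x j.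
Proof. by move=> ik jk; apply: contra => /eqP/(x_inj ik jk)->. Qed.

(** x_i and x_(i+2) are separated by x_(i+1) only, so an element can tell x_i from
x_(i+2d) only if it lies on the path between them. *)
Lemma path_run i d w : i + d.*2 < k ->
  (forall l, i <= l <= i + d.*2 -> w != x l) -> col w (x i) = col w (x (i + d.*2)).
Proof.
elim: d => [|d IHd] dk wx; first by rewrite addn0.
rewrite IHd; [|lia|by move=> l li; apply: wx; lia].
have -> : i + d.+1.*2 = (i + d.*2).+2 by lia.
apply: (elimT (twinP _ _ _ _) (x_twin _)); first by lia.
- by rewrite !inE; apply: wx; lia.
- by apply: wx; lia.
- by apply: wx; lia.
Qed.

Lemma path_run_on i j l : i <= j -> j < k -> odd i = odd j -> l < k ->
  l < i \/ j < l -> col (x l) (x i) = col (x l) (x j) /\ col (x i) (x l) = col (x j) (x l).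
Proof.
move=> ij jk oij lk out.
have e : col (x l) (x i) = col (x l) (x j).
  have -> : j = i + (j - i)./2.*2 by lia.
  by apply: path_run => [|m mi]; [lia|apply: x_neq; lia].
by split=> //; apply: col_flip => //; apply: x_neq; lia.
Qed.

Lemma path_run_off i j w : i <= j -> j < k -> odd i = odd j -> w \notin P ->
  col w (x i) = col w (x j) /\ col (x i) w = col (x j) w.
Proof.
move=> ij jk oij wP.
have wx m : m < k -> w != x m by move=> mk; apply: contraNneq wP => ->; apply/mem_path; exists m.
have e : col w (x i) = col w (x j).
  have -> : j = i + (j - i)./2.*2 by lia.
  by apply: path_run => [|m mi]; [lia|apply: wx; lia].
by split=> //; apply: col_flip => //; apply: wx; lia.
Qed.

(** Were the two ends also twins across the closing edges, then for odd k every
outside element would see the whole cycle alike, so the cycle would be all of T,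
of odd cardinality; for even k no element at all would separate x_0 from
x_(k-2): only x_(k-1) could, but the run from x_0 to x_(k-2) avoids it. *)
Lemma path_not_cycle : simple_on setT -> 2 < #|T| -> ~~ odd #|T| -> 2 < k ->
  twin [set~ x 0] (x 1) (x k.-1) -> twin [set~ x k.-1] (x k.-2) (x 0) -> False.
Proof.
move=> sT T3 eT k3 tw0 twk; have T3' : 2 < #|[set: T]| by rewrite cardsT.
have [ok|ek] := boolP (odd k).
  have mP : module_of setT P.
    apply/module_ofP=> w a b _ wP.
    suff key c : c \in P -> col w c = col w (x 0) by move=> aP bP; rewrite !key.
    have wx m : m < k -> w != x m.
      by move=> mk; apply: contraNneq wP => ->; apply/mem_path; exists m.
    have x1 : col w (x 1) = col w (x 0).
      rewrite (elimT (twinP _ _ _ _) tw0) ?inE ?wx //; try lia.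
      by symmetry; apply: (path_run_off _ _ _ wP).1; lia.
    case/mem_path=> i ik ->; have [oi|oi] := boolP (odd i).
      by rewrite -x1; symmetry; apply: (path_run_off _ _ _ wP).1; lia.
    by symmetry; apply: (path_run_off _ _ _ wP).1; lia.
  case: (elimT (simple_onP _ _) sT P (subsetT _) mP); rewrite ?card_path; first lia.
  by move=> e; have := card_path; rewrite e cardsT; lia.
have tw : twin setT (x 0) (x k.-2).
  apply/twinP=> w _ w0 w2; have [->|wk] := eqVneq w (x k.-1).
    by apply: (path_run_on _ _ _ _ _).1; lia.
  by rewrite [RHS](elimT (twinP _ _ _ _) twk) ?inE.
have x02 : x 0 != x k.-2 by apply: x_neq; lia.
by have := twin_not_simple (in_setT _) (in_setT _) x02 T3' tw; rewrite sT.
Qed.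

Hypothesis sT : simple_on setT.
Hypothesis T3 : 2 < #|T|.
Hypothesis eT : ~~ odd #|T|.
Hypothesis k2 : 1 < k.
Hypothesis corner_l : corner [set~ x 0] (x 1).
Hypothesis corner_r : corner [set~ x k.-1] (x k.-2).

Lemma corner_lE a b : a != x 0 -> a != x 1 -> b != x 0 -> b != x 1 ->
  col (x 1) a = col (x 1) b.
Proof. by move=> *; apply: (elimT (cornerP _ _ _) corner_l); rewrite ?inE. Qed.

Lemma corner_rE a b : a != x k.-1 -> a != x k.-2 -> b != x k.-1 -> b != x k.-2 ->
  col (x k.-2) a = col (x k.-2) b.
Proof. by move=> *; apply: (elimT (cornerP _ _ _) corner_r); rewrite ?inE. Qed.

(** An outside element sees x_i like x_1 if i is odd, and like x_(k-2) if i has the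
parity of k. If k is even, then the corner conditions at both ends make the
complement of the path a module, of even cardinality. If k is odd, then #|T| - k is odd, and
with an outside element as intermediary x_1 would see everything alike. *)
Lemma path_cover : k = #|T|.
Proof.
have T3' : 2 < #|[set: T]| by rewrite cardsT.
have out w m : w \notin P -> m < k -> w != x m.
  by move=> wP mk; apply: contraNneq wP => ->; apply/mem_path; exists m.
have cP := cardsC P; rewrite card_path in cP.
have [ok|ek] := boolP (odd k).
  have [v] : exists v, v \in ~: P by apply/card_gt0P; lia.
  rewrite inE => vP; have : corner setT (x 1).
    apply/cornerP=> a b _ _; suff key c : c != x 1 -> col (x 1) c = col (x 1) v.
      by move=> a1 b1; rewrite !key.
    move=> c1; have [->|c0] := eqVneq c (x 0); last by apply: corner_lE => //; apply: out => //; lia.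
    have -> : col (x 1) (x 0) = col (x k.-2) (x 0).
      by apply: (path_run_on _ _ _ _ _).2; lia.
    have -> : col (x 1) v = col (x k.-2) v.
      by apply: (path_run_off _ _ _ vP).2; lia.
    by apply: corner_rE; [apply: x_neq|apply: x_neq|apply: out|apply: out] => //; lia.
  by move/(corner_not_simple (in_setT _) T3'); rewrite sT.
case: (elimT (simple_onP _ _) sT (~: P) (subsetT _)).
- apply/module_ofP=> w a b _; rewrite !inE negbK => /mem_path[i ik ->] aP bP.
  have [oi|oi] := boolP (odd i).
    have flip c : c \notin P -> col (x i) c = col (x 1) c.
      by move=> cP'; symmetry; apply: (path_run_off _ _ _ cP').2; lia.
    by rewrite !flip //; apply: corner_lE; rewrite out //; lia.
  have flip c : c \notin P -> col (x i) c = col (x k.-2) c.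
    by move=> cP'; apply: (path_run_off _ _ _ cP').2; lia.
  by rewrite !flip //; apply: corner_rE; rewrite out //; lia.
- by lia.
- move/setP/(_ (x 0)); rewrite !inE => /negP[]; apply/mem_path; exists 0 => //; lia.
Qed.

(** Propagation moves an index of the pair (x_i, x_j) towards an end of the path, as
long as the run avoids the other index; at the ends, the corner conditions give
the colour. If e were c, then x_0 would see everything alike; if e were the
opposite of c, then x_1 would. *)
Lemma path_colors : 3 < k -> exists c e, [/\ e != c, e != inv c &
  forall i j, i < j < k -> col (x i) (x j) = if ~~ odd i && odd j then e else c].
Proof.
move=> k4; have kT := path_cover.
have T3' : 2 < #|[set: T]| by rewrite cardsT.
pose c := col (x 1) (x 2); pose e := col (x 0) (x 1).
have pat i j : i < j < k -> col (x i) (x j) = if ~~ odd i && odd j then e else c.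
  move=> ij; have [oi|oi] := boolP (odd i) => /=.
    have <- : col (x 1) (x j) = col (x i) (x j).
      by apply: (path_run_on _ _ _ _ _).2; lia.
    by apply: corner_lE; apply: x_neq; lia.
  have [oj|oj] := boolP (odd j).
    have <- : col (x 0) (x j) = col (x i) (x j).
      by apply: (path_run_on _ _ _ _ _).2; lia.
    by symmetry; apply: (path_run_on _ _ _ _ _).1; lia.
  rewrite /c colC ?[RHS]colC; try by apply: x_neq; lia.
  congr inv; have -> : col (x j) (x i) = col (x k.-2) (x i).
    by apply: (path_run_on _ _ _ _ _).2; lia.
  have -> : col (x 2) (x 1) = col (x k.-2) (x 1).
    by apply: (path_run_on _ _ _ _ _).2; lia.
  by apply: corner_rE; apply: x_neq; lia.
have all_x z : exists2 i, i < k & z = x i.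
  apply/mem_path; suff -> : P = setT by [].
  by apply/eqP; rewrite eqEcard subsetT cardsT card_path kT /=.
exists c, e; split=> //; apply/negP=> /eqP ec.
- have : corner setT (x 0).
    apply/cornerP=> a b _ _; suff key z : z != x 0 -> col (x 0) z = c.
      by move=> a0 b0; rewrite !key.
    case: (all_x z) => -[|i] ik ->; first by rewrite eqxx.
    by rewrite pat // ec; case: ifP.
  by move/(corner_not_simple (in_setT _) T3'); rewrite sT.
- have : corner setT (x 1).
    apply/cornerP=> a b _ _; suff key z : z != x 1 -> col (x 1) z = c.
      by move=> a1 b1; rewrite !key.
    case: (all_x z) => -[|[|i]] ik ->; rewrite ?eqxx // => _; last by rewrite pat.
    rewrite colC; last by apply: x_neq; lia.
    by rewrite -/e ec /c -colC -?colC //; apply: x_neq; lia.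
  by move/(corner_not_simple (in_setT _) T3'); rewrite sT.
Qed.

End Path.
(** * Simple structures without simple one-point deletions *)

Section Critical.

Hypothesis sT : simple_on setT.
Hypothesis crit : forall x, ~~ simple_on [set~ x].

Lemma grow k X : simple_on X -> 2 < #|X| -> #|X| + k.*2 <= #|T| ->
  exists2 Y, simple_on Y & #|Y| = #|X| + k.*2.
Proof.
elim: k X => [|k IHk] X sX X3 XT; first by exists X; rewrite ?addn0.
case: (boolP [exists v, [exists w, [&& v \notin X, w \notin X, v != w &
                simple_on (v |: (w |: X))]]]).
  case/existsP=> v /existsP[w /and4P[vX wX vw sY]].
  have cY : #|v |: (w |: X)| = #|X|.+2.
    by rewrite !cardsU1 !inE negb_or vw vX wX.
  case: (IHk _ sY); rewrite ?cY; try lia.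
  by move=> Y sY' e; exists Y => //; lia.
move=> none; suff : #|T| <= #|X|.+1 by lia.
apply: (stuck_card sX X3 sT) => v w vX wX vw.
apply: contra none => s2.
by apply/existsP; exists v; apply/existsP; exists w; rewrite vX wX vw.
Qed.

(** Growing from size 4 by steps of two would reach a simple set of size #|T| - 1. *)
Lemma critical_even X : simple_on X -> #|X| = 4 -> ~~ odd #|T|.
Proof.
move=> sX X4; apply/negP=> oT.
have XT := subset_leq_card (subsetT X); rewrite cardsT X4 in XT.
have [||Y sY cY] := @grow (#|T| - 5)./2 X sX; rewrite ?X4; try lia.
have /cards1P[x Yx] : #|~: Y| == 1 by have := cardsC Y; lia.
by have := crit x; rewrite -Yx setCK sY.
Qed.

Definition adj x y := (x != y) && simple_on (~: [set x; y]).

Lemma adjC x y : adj x y = adj y x.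
Proof. by rewrite /adj eq_sym setUC. Qed.

Lemma exists_adj X : simple_on X -> #|X| = 4 -> 4 < #|T| -> exists x y, adj x y.
Proof.
move=> sX X4 T5; have eT := critical_even sX X4.
have [||Y sY cY] := @grow (#|T| - 6)./2 X sX; rewrite ?X4; try lia.
have /cards2P[x [y [xy Yxy]]] : #|~: Y| == 2 by have := cardsC Y; lia.
by exists x, y; rewrite /adj xy -Yxy setCK.
Qed.

Hypothesis T5 : 4 < #|T|.

Lemma card_compl2 x y : x != y -> 2 < #|~: [set x; y]|.
Proof. by move=> xy; have := cardsC [set x; y]; rewrite cards2 xy; lia. Qed.

(** Exchanging the twins y and z is a colour-preserving bijection between the
complements of {x, z} and {x, y}. *)
Lemma twin_swap x y z : adj x y -> z != x -> z != y -> twin [set~ x] y z -> adj x z.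
Proof.
move=> /andP[xy sxy] zx zy /twinP tw; rewrite /adj eq_sym zx /=.
apply: (@simple_transfer _ _ _ _ col (tperm y z)) (perm_inj (s:=_)) _ _ => [a b|].
  rewrite !inE !negb_or => /andP[ax az] /andP[bx bz] ab.
  have [ay|ay] := eqVneq a y.
    rewrite ay tpermL tpermD; last 2 first.
    - by rewrite -ay.
    - by rewrite eq_sym.
    have by_ : b != y by rewrite -ay eq_sym.
    by apply: col_flip => //; apply/esym/tw; rewrite ?inE.
  have [by_|by_] := eqVneq b y.
    rewrite by_ tpermL tpermD 1?eq_sym //; apply: esym.
    by apply: tw; rewrite ?inE.
  by rewrite !tpermD // eq_sym.
suff -> : tperm y z @: (~: [set x; z]) = ~: [set x; y] by [].
apply/setP=> w; rewrite -{1}[w](tpermK y z) mem_imset ?inE; last exact: perm_inj.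
case: tpermP => [->|->|/eqP/negPf wy /eqP/negPf wz]; rewrite ?eqxx ?orbT //.
  by rewrite eq_sym (negPf xy) (negPf zx) eq_sym (negPf zy).
by rewrite wy wz.
Qed.

(** The complement of x is not simple and arises from a simple set by adding y, so
[add_one] applies; a twin of y inherits the adjacency to x. *)
Lemma adj_or x y : adj x y ->
  corner [set~ x] y \/ exists z, [/\ z != x, z != y & adj x z].
Proof.
move=> axy; have /andP[xy sxy] := axy;
have e : y |: ~: [set x; y] = [set~ x].
  apply/setP=> w; rewrite !inE; have [->|] := eqVneq w y; first by rewrite eq_sym xy.
  by rewrite orbF.
have yX : y \notin ~: [set x; y] by rewrite !inE eqxx orbT.
case: (add_one sxy yX); rewrite ?e ?crit //.
- move/cornerP=> cy; left; apply/cornerP=> a b; rewrite !inE => ax bx ay by_.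
  by apply: cy; rewrite ?inE ?negb_or ?ax ?ay ?bx ?by_.
- case=> z; rewrite !inE negb_or => /andP[zx zy] /twinP tw.
  right; exists z; split=> //; apply: (twin_swap axy) => //.
  rewrite twinC; apply/twinP=> w; rewrite !inE => wx wz wy; apply: tw => //.
  by rewrite !inE negb_or wx.
Qed.

(** The corner or twin structure that y has in the complement of x passes to the
complement of {x, z}, which is simple; this excludes everything but twins y, z. *)
Lemma adj_twin x y z : adj x y -> adj x z -> y != z -> twin [set~ x] y z.
Proof.
move=> axy axz yz; have /andP[xy sxy] := axy; have /andP[xz sxz] := axz.
have sub u : ~: [set x; u] \subset [set~ x].
  by apply/subsetP=> w; rewrite !inE negb_or => /andP[].
have in_z : y \in ~: [set x; z] by rewrite !inE negb_or eq_sym xy.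
have e : y |: ~: [set x; y] = [set~ x].
  apply/setP=> w; rewrite !inE; have [->|] := eqVneq w y; first by rewrite eq_sym xy.
  by rewrite orbF.
have yX : y \notin ~: [set x; y] by rewrite !inE eqxx orbT.
have X3 := card_compl2 xz.
case: (add_one sxy yX); rewrite ?e ?crit //.
- move/cornerP=> cy; have : corner (~: [set x; z]) y.
    apply/cornerP=> a b; rewrite !inE !negb_or => /andP[ax _] /andP[bx _] ay by_.
    by apply: cy; rewrite ?inE ?negb_or ?ax ?ay ?bx ?by_.
  by move/(corner_not_simple in_z X3); rewrite sxz.
- case=> t; rewrite !inE negb_or => /andP[tx ty] /twinP tw.
  have tw' : twin [set~ x] y t.
    rewrite twinC; apply/twinP=> w; rewrite !inE => wx wt wy; apply: tw => //.
    by rewrite !inE negb_or wx.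
  have [<- //|tz] := eqVneq t z.
  have in_t : t \in ~: [set x; z] by rewrite !inE negb_or tx.
  have := subset_twin (sub z) tw'.
  by rewrite twinC; move/(twin_not_simple in_t in_z ty X3); rewrite sxz.
Qed.

(** The neighbours y and z would be twins inside the simple complement of {x, t}. *)
Lemma adj_three x y z t : adj x y -> adj x z -> adj x t ->
  y != z -> y != t -> z != t -> False.
Proof.
move=> axy axz axt yz yt zt; have /andP[xt sxt] := axt.
have /andP[xy _] := axy; have /andP[xz _] := axz.
have tw := adj_twin axy axz yz.
have sub : ~: [set x; t] \subset [set~ x].
  by apply/subsetP=> w; rewrite !inE negb_or => /andP[].
have yS : y \in ~: [set x; t] by rewrite !inE negb_or eq_sym xy.
have zS : z \in ~: [set x; t] by rewrite !inE negb_or eq_sym xz.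
have S3 := card_compl2 xt.
by have := subset_twin sub tw; move/(twin_not_simple yS zS yz S3); rewrite sxt.
Qed.


Definition adj_path s := uniq s && sorted adj s.

Lemma adj_path_rev s : adj_path (rev s) = adj_path s.
Proof.
rewrite /adj_path rev_uniq rev_sorted; congr (_ && _).
by apply: eq_sorted => u v; rewrite adjC.
Qed.

Lemma adj_path_cons s z y0 : adj_path s -> 0 < size s -> adj z (nth y0 s 0) ->
  z \notin s -> adj_path (z :: s).
Proof.
case: s => // a s /andP[us ss] _ za zs.
rewrite /adj_path cons_uniq zs us /=; exact/andP.
Qed.

Lemma exists_longest_path u v : adj u v -> exists s,
  [/\ adj_path s, 1 < size s & forall t : seq T, adj_path t -> size t <= size s].
Proof.
move=> uv; pose p k := [exists t : k.-tuple T, adj_path t].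
have pP s : adj_path s -> p (size s) by move=> ps; apply/existsP; exists (in_tuple s).
have puv : p 2.
  by apply: (pP [:: u; v]); rewrite /adj_path /= inE uv; case/andP: uv => ->.
have bound k : p k -> k <= #|T|.
  by case/existsP=> t /andP[/card_uniqP e _]; rewrite -(size_tuple t) -e max_card.
have [k /existsP[t pt] maxk] := ex_maxnP (ex_intro _ 2 puv) bound.
exists t; split=> //; rewrite size_tuple; first exact: maxk.
by move=> s /pP/maxk.
Qed.

(** If x_1 is not in a corner, then x_0 has a second neighbour, which is on the path
by maximality. It is not an inner vertex, as these already have two neighbours on
the path; so it is the last vertex. *)
Lemma path_start s y0 (x := nth y0 s) : adj_path s -> 1 < size s ->
    (forall t : seq T, adj_path t -> size t <= size s) ->
  corner [set~ x 0] (x 1) \/ 2 < size s /\ adj (x 0) (x (size s).-1).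
Proof.
move=> ps s2 maxs; have /andP[us /(sortedP y0) ss] := ps.
have xn i j : i < size s -> j < size s -> i != j -> x i != x j.
  by move=> si sj ij; rewrite nth_uniq.
have a01 : adj (x 0) (x 1) by apply: ss.
case: (adj_or a01) => [|[z [z0 z1 a0z]]]; [by left|right].
have [zs|zs] := boolP (z \in s); last first.
  have /maxs /= : adj_path (z :: s) by apply: (adj_path_cons (y0 := y0) ps (ltnW s2)) => //; rewrite adjC.
  by rewrite ltnn.
have ez : z = x (index z s) by rewrite /x nth_index.
have jk : index z s < size s by rewrite index_mem.
move: (index z s) ez jk => j ez jk.
have j0 : j != 0 by apply: contraNneq z0 => e; rewrite ez e.
have j1 : j != 1 by apply: contraNneq z1 => e; rewrite ez e.
have [jlast|jlast] := eqVneq j (size s).-1; first by rewrite -jlast -ez; split=> //; lia.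
have jn : j.+1 < size s by lia.
have jp : j.-1.+1 = j by lia.
have am : adj (x j) (x j.-1) by rewrite adjC -[in X in adj _ X]jp; apply: ss; rewrite jp.
have ap : adj (x j) (x j.+1) by apply: ss.
have a0 : adj (x j) (x 0) by rewrite adjC -ez.
have [d1 d2] : j.-1 != j.+1 /\ j.-1 != 0 by clear - j0 j1; lia.
by case: (adj_three am ap a0); apply: xn => //; clear - jk jn; lia.
Qed.

(** A longest path of adjacent elements satisfies the hypotheses of [path_colors]. *)
Lemma critical_colors X : simple_on X -> #|X| = 4 -> exists (x : nat -> T) c e,
  [/\ e != c, e != inv c,
      forall i j, i < #|T| -> j < #|T| -> x i = x j -> i = j &
      forall i j, i < j < #|T| -> col (x i) (x j) = if ~~ odd i && odd j then e else c].
Proof.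
move=> sX X4; have eT := critical_even sX X4; have T3 : 2 < #|T| by lia.
have [u [v uv]] := exists_adj sX X4 T5.
have [s [ps s2 maxs]] := exists_longest_path uv.
have /andP[us /(sortedP u) ss] := ps.
have s1 : (size s).-1 < size s by lia.
have s0 : (size s) - (size s).-1.+1 = 0 by lia.
have start := path_start u ps s2 maxs.
have stop := @path_start (rev s) u.
rewrite adj_path_rev size_rev in stop; have {maxs stop ps} := stop ps s2 maxs.
rewrite !nth_rev ?(ltnW s2) // s0 subn1 subn2 => {s0 s1} stop.
have xn i j : i < size s -> j < size s -> i != j -> nth u s i != nth u s j.
  by move=> si sj ij; rewrite nth_uniq.
move: (nth u s) (size s) s2 start stop ss xn => x k k2 start stop ss xn {us s}.
have x_inj i j : i < k -> j < k -> x i = x j -> i = j.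
  by move=> si sj e; apply/eqP; apply: contraT => /(xn _ _ si sj); rewrite e eqxx.
have x_twin i : i.+2 < k -> twin [set~ x i.+1] (x i) (x i.+2).
  move=> ik; apply: adj_twin.
  - by rewrite adjC; apply: ss; apply: ltnW.
  - exact: ss.
  - by apply: xn; lia.
have ncyc : 2 < k -> adj (x 0) (x k.-1) -> False.
  move=> k3 a0k; apply: (path_not_cycle x_inj x_twin sT T3 eT k3); apply: adj_twin.
  - by apply: ss; lia.
  - by [].
  - by apply: xn; lia.
  - have <- : k.-2.+1 = k.-1 by lia.
    by rewrite adjC; apply: ss; lia.
  - by rewrite adjC.
  - by apply: xn; lia.
have cl : corner [set~ x 0] (x 1) by case: start => // -[/ncyc].
have cr : corner [set~ x k.-1] (x k.-2).
  by case: stop => // -[/ncyc nc]; rewrite adjC => /nc.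
have kT := path_cover x_inj x_twin sT T3 eT k2 cl cr.
have [|c [e [ec eic pat]]] := path_colors x_inj x_twin sT T3 eT k2 cl cr; first by lia.
by exists x, c, e; split=> //; rewrite -kT. 
Qed.

End Critical.
End Structure.

(** * The colouring of a permutation by quadrants *)

Section Quadrants.

Variables (n : nat) (s : 'S_n).

Definition quadrant (a b : 'I_n) : bool * bool := (a < b, s a < s b).

Definition opposite (c : bool * bool) : bool * bool := (~~ c.1, ~~ c.2).

Lemma perm_val_eq (a b : 'I_n) : (s a == s b :> nat) = (a == b :> nat).
Proof. by rewrite !val_eqE (inj_eq perm_inj). Qed.

Lemma perm_val_neq (a b : 'I_n) : a != b -> s a != s b :> nat.
Proof. by rewrite val_eqE (inj_eq perm_inj). Qed.

Lemma quadrantC a b : a != b -> quadrant b a = opposite (quadrant a b).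
Proof.
move=> ab; rewrite /quadrant /opposite /=.
have sab := perm_val_eq a b; rewrite -val_eqE /= in ab.
by congr (_, _); lia.
Qed.

Lemma contiguousP (A : {set 'I_n}) : contiguous A <->
  forall w a b, w \notin A -> a \in A -> b \in A -> (w < a) = (w < b).
Proof.
split=> [cA w a b wA aA bA|H i j k iA jA /andP[ik kj]].
  apply/idP/idP=> [wa|wb]; rewrite ltnNge; apply: contraNN wA => le.
    by apply: (cA b a) => //; rewrite le ltnW.
  by apply: (cA a b) => //; rewrite le ltnW.
apply: contraT => kA; have ki : (k < i) = false by lia.
have := H k i j kA iA jA; rewrite ki; have : k != j by apply: contraNneq kA => ->.
by rewrite -val_eqE /= => ? ?; lia.
Qed.

Lemma perm_intervalP (A : {set 'I_n}) :
  perm_interval s A <-> module_of quadrant setT A.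
Proof.
split=> [[/contiguousP cA /contiguousP csA]|/module_ofP mA].
  apply/module_ofP=> w a b _ wA aA bA; congr (_, _); first exact: cA.
  by apply: csA; rewrite ?mem_imset //; apply: perm_inj.
split; apply/contiguousP.
  by move=> w a b wA aA bA; case: (mA w a b (in_setT _) wA aA bA).
move=> w _ _ wA /imsetP[a aA ->] /imsetP[b bA ->].
rewrite -(permKV s w) mem_imset in wA *; last exact: perm_inj.
by case: (mA _ a b (in_setT _) wA aA bA).
Qed.

Lemma simple_permP : simple_perm s <-> simple_on quadrant setT.
Proof.
split=> [sS|/simple_onP sS A /perm_intervalP mA].
  apply/simple_onP=> A _ /perm_intervalP /sS[->|->|cA]; [by left|by left|right].
  by apply/eqP; rewrite eqEcard subsetT cardsT card_ord cA /=.
case: (sS A (subsetT A) mA) => [|->]; last by constructor 3; rewrite cardsT card_ord.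
by case: #|A| => [|[|]] // _; [constructor 1|constructor 2].
Qed.

End Quadrants.

Lemma simple_perm_del n (s : 'S_n) (x : 'I_n) :
  simple_on (quadrant s) [set~ x] -> simple_perm (perm_del s x).
Proof.
move=> sx; apply/simple_permP.
apply: (@simple_transfer _ _ _ _ (quadrant s) (lift x)); first exact: lift_inj.
  move=> a b _ _ ab; rewrite /quadrant -!lift_perm_del /= !ltnNge.
  by rewrite !leq_bump2.
suff -> : lift x @: setT = [set~ x] by [].
apply/setP=> w; rewrite !inE; case: (unliftP x w) => [j ->|->].
  by rewrite eq_sym neq_lift mem_imset ?inE //; apply: lift_inj.
rewrite eqxx; apply/imsetP=> -[j _ /eqP]; by rewrite (negPf (neq_lift x j)).
Qed.

(** * Recognising parallel alternations *)

Section Zigzag.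

Variables (m : nat).

Lemma card_ltn n k : k <= n -> #|[set i : 'I_n | i < k]| = k.
Proof.
move=> kn; rewrite -sum1_card (eq_bigl (fun i : 'I_n => i < k)) => [|i]; last by rewrite inE.
by rewrite -(big_ord_widen n (fun=> 1)) // sum1_card card_ord.
Qed.

Lemma perm_rank n (s : 'S_n) i : #|[set j | s j < s i]| = s i.
Proof.
have -> : [set j | s j < s i] = s @^-1: [set k : 'I_n | k < s i].
  by apply/setP=> j; rewrite !inE.
by rewrite card_preimset ?card_ltn //; [apply: ltnW|apply: perm_inj].
Qed.

Lemma card_parity k b : #|[set i : 'I_k.*2 | odd i == b]| = k.
Proof.
rewrite -sum1_card (eq_bigl (fun i : 'I_k.*2 => odd i == b)) => [|i]; last by rewrite inE.
rewrite big_mkcond -(big_mkord xpredT (fun i => if odd i == b then 1 else 0)) /=.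
elim: k => [|k IHk]; first by rewrite big_geq.
by rewrite doubleS !big_nat_recr //= IHk odd_double {IHk}; case: b; rewrite /= ?addn0 addn1.
Qed.

(** The entries at positions of one parity all lie below the others. There are m of
each kind, so, by counting the entries below a given one, they are exactly the
low half. *)
Lemma zigzag_horizontal n (s : 'S_n) b : n = 2 * m ->
  (forall i j : 'I_n, i < j -> (s i < s j) = b (+) (~~ odd i && odd j)) ->
  horizontal_parallel_alternation s m.
Proof.
rewrite mul2n => en; move: s; rewrite en => s H.
pose L := [set i : 'I_m.*2 | odd i == b].
have cL : #|L| = m by apply: card_parity.
have below i j : i \in L -> j \notin L -> s i < s j.
  rewrite !inE => oi oj; case: (ltngtP i j) => ij.
  - by rewrite H //; case: b oi oj {H L cL}; case: (odd i); case: (odd j).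
  - rewrite ltnNge leq_eqVlt negb_or H // perm_val_eq.
    apply/andP; split; first by lia.
    by case: b oi oj {H L cL}; case: (odd i); case: (odd j).
  - by rewrite -(val_inj ij) oi in oj.
have lowE i : (s i < m) = (odd i == b).
  have -> : (odd i == b) = (i \in L) by rewrite inE.
  apply/idP/idP => iL; last first.
    suff : s i < #|L| by rewrite cL.
    rewrite -(perm_rank s i) (cardsD1 i L) iL ltnS subset_leq_card //.
    apply/subsetP=> j; rewrite !inE => sji; apply/andP; split.
      by apply: contraTneq sji => ->; rewrite ltnn.
    by apply: contraTT sji => oj; rewrite -leqNgt ltnW // below // inE.
  apply: contraTT iL => iL; rewrite -leqNgt.
  suff : #|L| <= s i by rewrite cL.
  rewrite -(perm_rank s i) subset_leq_card //.
  by apply/subsetP=> j jL; rewrite inE below.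
have highE i : (m <= s i) = (odd i != b) by rewrite leqNgt lowE.
split; last first.
  move=> i j ij; rewrite !inE !lowE !highE ij oddS.
  by case: (odd i); case: b {H L cL below lowE highE}; [left|right|right|left].
case: b H {L cL below} lowE highE => H lowE highE; [left|right]; split=> i j;
  rewrite !inE ?lowE ?highE => oi oj ij.
- by rewrite H //; case: (odd i) oi; case: (odd j) oj.
- by rewrite H //; case: (odd i) oi; case: (odd j) oj.
- have := H _ _ ij; have := perm_val_eq s i j; case: (odd i) oi; case: (odd j) oj => //=; lia.
- have := H _ _ ij; have := perm_val_eq s i j; case: (odd i) oi; case: (odd j) oj => //=; lia.
Qed.

Lemma horizontal_vertical n (s : 'S_n) :
  horizontal_parallel_alternation s^-1%g m -> vertical_parallel_alternation s m.
Proof.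
have lowE : s @: [set i : 'I_n | i < m] = [set i | (s^-1)%g i < m].
  apply/setP=> i; rewrite -[i in LHS](permKV s) mem_imset ?inE //; exact: perm_inj.
have highE : s @: [set i : 'I_n | m <= i] = [set i | m <= (s^-1)%g i].
  apply/setP=> i; rewrite -[i in LHS](permKV s) mem_imset ?inE //; exact: perm_inj.
case=> mon alt; split; last by rewrite lowE highE.
have inc (p : pred nat) : increasing_on s^-1%g [set i | p ((s^-1)%g i)] ->
    increasing_on s [set i : 'I_n | p i].
  move=> H i j; rewrite !inE => pi pj ij.
  have := H (s j) (s i); rewrite !inE !permK => /(_ pj pi).
  have := perm_val_eq s i j; lia.
have dec (p : pred nat) : decreasing_on s^-1%g [set i | p ((s^-1)%g i)] ->
    decreasing_on s [set i : 'I_n | p i].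
  move=> H i j; rewrite !inE => pi pj ij.
  have := H (s i) (s j); rewrite !inE !permK => /(_ pi pj).
  have := perm_val_eq s i j; lia.
case: mon => -[H1 H2]; [left|right]; split.
- exact: (inc (fun k => k < m)).
- exact: (inc (fun k => m <= k)).
- exact: (dec (fun k => k < m)).
- exact: (dec (fun k => m <= k)).
Qed.

(** A strictly increasing self-map of {0, ..., n-1} satisfies f i >= i by induction
from the left end and f i <= i by induction from the right end. *)
Lemma increasing_id n (f : nat -> nat) :
  (forall i, i < n -> f i < n) -> (forall i j, i < j < n -> f i < f j) ->
  forall i, i < n -> f i = i.
Proof.
move=> fn mono i iN; have lower j : j < n -> j <= f j.
  by elim: j => // j IHj jn; have := mono j j.+1; have := IHj (ltnW jn); lia.
have upper d : d < n -> f (n - d.+1) <= n - d.+1.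
  elim: d => [|d IHd] dn; first by have := fn (n - 1); lia.
  by have := mono (n - d.+2) (n - d.+1); have := IHd (ltnW dn); lia.
have := upper (n - i.+1); have -> : n - (n - i.+1).+1 = i by lia.
by have := lower i iN; lia.
Qed.

(** The positions are monotone along the enumeration y, so y is the identity or the
reversal of the positions. The reversal exchanges the parities, as n is even, as
well as the two ends of each pair, so the parity condition is kept and only the
direction c changes. *)
Lemma zigzag_enum n (t : 'S_n) (y : nat -> 'I_n) b c : n = 2 * m ->
  (forall i j, i < n -> j < n -> y i = y j -> i = j) ->
  (forall i j, i < j < n -> (y i < y j) = b) ->
  (forall i j, i < j < n -> (t (y i) < t (y j)) = c (+) (~~ odd i && odd j)) ->
  horizontal_parallel_alternation t m.
Proof.
move=> nm y_inj yb tc; apply: (@zigzag_horizontal _ _ (c (+) ~~ b)) => // i j ij.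
have jn := ltn_ord j; case: b yb => yb.
  have yE (k : 'I_n) : y k = k.
    by apply: val_inj; apply: (increasing_id (n := n) (f := y)) => // i' j' /yb.
  by have := tc i j; rewrite !yE ij jn addbF; apply.
have yE (k : 'I_n) : y (n - k.+1) = k.
  apply: val_inj; apply: (increasing_id (n := n) (f := fun k => y (n - k.+1))) => //.
  move=> i' j' ij'; rewrite ltn_neqAle leqNgt yb; last by lia.
  rewrite andbT val_eqE; apply/negP=> /eqP /y_inj; lia.
have := tc (n - j.+1) (n - i.+1); have := perm_val_eq t i j; rewrite !yE => st.
have -> : odd (n - j.+1) = ~~ odd j by lia.
have -> : odd (n - i.+1) = ~~ odd i by lia.
by case: c {tc}; case: (odd i); case: (odd j) => /=; lia.
Qed.


End Zigzag.

(** * Simple patterns of length four *)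

Section Pattern.

Variables (n : nat) (s : 'S_n).
(** Reading direction from left to right or from right to left, which reduces the
patterns 3142 and 2413 to one. *)
Definition before (d : bool) (i j : 'I_n) := if d then i < j else j < i.

Lemma before_irr d : irreflexive (before d).
Proof. by move=> i; rewrite /before; case: d; apply: ltnn. Qed.

Lemma before_trans d i j k : before d i j -> before d j k -> before d i k.
Proof. by rewrite /before; case: d; lia. Qed.

Lemma before_total d i j : i != j -> before d i j || before d j i.
Proof. by rewrite -val_eqE /before /=; case: d; lia. Qed.

Lemma before_asym d i j : before d i j -> before d j i = false.
Proof. by rewrite /before; case: d; lia. Qed.

(** Read in direction d, the entries x, y, p, b form the pattern 3142. *)
Lemma zigzag4_simple d x y p b :
  [/\ before d x y, before d y p & before d p b] ->
  [/\ s y < s b, s b < s x & s x < s p] ->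
  simple_on (quadrant s) [set x; y; p; b] /\ #|[set x; y; p; b]| = 4.
Proof.
move=> [xy yp pb] [yb bx xp].
have xp' := before_trans xy yp; have yb' := before_trans yp pb.
have xb' := before_trans xp' pb.
have neq i j : before d i j -> i != j by apply: contraTneq => ->; rewrite before_irr.
have c4 : #|[set x; y; p; b]| = 4.
  rewrite -!setUA !cardsU1 cards1 !inE !negb_or.
  by rewrite !neq.
split=> //; apply/simple_onP=> A AS /module_ofP mA.
have vals w u v : w \in [set x; y; p; b] -> s u < s w -> s w < s v ->
    u \in A -> v \in A -> w \in A.
  move=> wS uw wv uA vA; apply: contraT => wA.
  by have [_] := mA w u v wS wA uA vA; rewrite wv ltnNge ltnW.
have poss w u v : w \in [set x; y; p; b] -> before d u w -> before d w v ->
    u \in A -> v \in A -> w \in A.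
  move=> wS uw wv uA vA; apply: contraT => wA.
  have [e _] := mA w u v wS wA uA vA; move: uw wv e; rewrite /before.
  by clear; case: d; lia.
have inS w : w \in [set x; y; p; b] = [|| w == x, w == y, w == p | w == b].
  by rewrite !inE -!orbA.
have xy_b : x \in A -> y \in A -> b \in A.
  by move=> xA yA; apply: (vals b y x); rewrite // inS eqxx !orbT.
have py_b : p \in A -> y \in A -> b \in A.
  by move=> pA yA; apply: (vals b y p); rewrite // ?inS ?eqxx ?orbT //; apply: ltn_trans xp.
have py_x : p \in A -> y \in A -> x \in A.
  by move=> pA yA; apply: (vals x y p); rewrite // ?inS ?eqxx ?orbT //; apply: ltn_trans bx.
have pb_x : p \in A -> b \in A -> x \in A.
  by move=> pA bA; apply: (vals x b p); rewrite // inS eqxx ?orbT.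
have xp_y : x \in A -> p \in A -> y \in A.
  by move=> xA pA; apply: (poss y x p); rewrite // inS eqxx ?orbT.
have xb_y : x \in A -> b \in A -> y \in A.
  by move=> xA bA; apply: (poss y x b); rewrite // inS eqxx ?orbT.
have xb_p : x \in A -> b \in A -> p \in A.
  by move=> xA bA; apply: (poss p x b); rewrite // inS eqxx ?orbT.
have yb_p : y \in A -> b \in A -> p \in A.
  by move=> yA bA; apply: (poss p y b); rewrite // inS eqxx ?orbT.
have all4 : x \in A -> y \in A -> p \in A -> b \in A -> A = [set x; y; p; b].
  move=> xA yA pA bA; apply/eqP; rewrite eqEsubset AS.
  by apply/subsetP=> w; rewrite inS => /or4P[]/eqP->.
have one t : (forall w, w \in A -> w = t) -> #|A| <= 1.
  move=> At; rewrite -(cards1 t) subset_leq_card //.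
  by apply/subsetP=> w /At->; rewrite set11.
have memA w : w \in A -> [\/ w = x, w = y, w = p | w = b].
  move/(subsetP AS); rewrite inS.
  by case/or4P=> /eqP->; [constructor 1|constructor 2|constructor 3|constructor 4].
have [xA|xA] := boolP (x \in A).
  have [yA|yA] := boolP (y \in A).
    by right; apply: all4; auto.
  left; apply: (one x) => w wA; case: (memA w wA) => // e; move: (wA); rewrite e => eA.
  - by rewrite eA in yA.
  - by rewrite xp_y in yA.
  - by rewrite xb_y in yA.
have [pA|pA] := boolP (p \in A).
  left; apply: (one p) => w wA; case: (memA w wA) => // e; move: (wA); rewrite e => eA.
  - by rewrite eA in xA.
  - by rewrite py_x in xA.
  - by rewrite pb_x in xA.
left; have [yA|yA] := boolP (y \in A).
  apply: (one y) => w wA; case: (memA w wA) => // e; move: (wA); rewrite e => eA.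
  - by rewrite eA in xA.
  - by rewrite eA in pA.
  - by rewrite yb_p in pA.
apply: (one b) => w wA; case: (memA w wA) => // e; move: (wA); rewrite e => eA.
- by rewrite eA in xA.
- by rewrite eA in yA.
- by rewrite eA in pA.
Qed.

Hypothesis s_simple : simple_on (quadrant s) setT.
Hypothesis n3 : 2 < n.

(** Let p and q be the entries of largest and second largest value, read in the
direction in which q comes before p. Let b be the largest entry after p, which
exists because p is not in a corner. The entries above b include p and q, but
not b, and none comes after p; they do not form an interval although their
values are contiguous, so an entry w below b is positioned between two of them.
Then an entry x above b before w, followed by w, p and b, is the pattern 3142. *)
Lemma exists_zigzag4 : exists d x y p b,
  [/\ before d x y, before d y p & before d p b] /\
  [/\ s y < s b, s b < s x & s x < s p].
Proof.
have T3 : 2 < #|[set: 'I_n]| by rewrite cardsT card_ord.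
have top1 : n.-1 < n by lia.
have top2 : n.-2 < n by lia.
have [p sp] : exists p, s p = n.-1 :> nat by exists ((s^-1)%g (Ordinal top1)); rewrite permKV.
have [q sq] : exists q, s q = n.-2 :> nat by exists ((s^-1)%g (Ordinal top2)); rewrite permKV.
have pq : p != q by apply/eqP=> e; move: sp; rewrite e sq; lia.
have [d dqp] : exists d, before d q p.
  by exists (q < p); rewrite /before; case: ifP => // qp; rewrite -val_eqE /= in pq; lia.
have below z : z != p -> s z < s p.
  by move=> zp; have := perm_val_eq s z p; have := ltn_ord (s z); move: zp; rewrite -val_eqE /= sp; lia.
have [b0 db0] : exists b, before d p b.
  case: (boolP [exists b, before d p b]) => [/existsP //|/existsPn none].
  have : corner (quadrant s) setT p.
    apply/cornerP=> u v _ _ up vp.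
    have key z : z != p -> quadrant s p z = (~~ d, false).
      move=> zp; have := none z; have := below z zp; rewrite -val_eqE /= in zp.
      by rewrite /quadrant /before; case: (d) => /= ? ?; congr (_, _); lia.
    by rewrite !key.
  by move/(corner_not_simple (in_setT _) T3); rewrite s_simple.
case: (arg_maxnP (fun z => s z) db0) => b db maxb.
pose A := [set z | s b < s z].
have bp : b != p by apply: contraTneq db => ->; rewrite before_irr.
have bq : b != q by apply: contraTneq db => ->; rewrite (before_asym dqp).
have bA : b \notin A by rewrite inE ltnn.
have pA : p \in A by rewrite inE below.
have qA : q \in A.
  by rewrite inE; have := below b bp; have := perm_val_neq s bq; rewrite sp sq; lia.
have : ~~ module_of (quadrant s) setT A.
  apply/negP=> /(elimT (simple_onP _ _) s_simple A (subsetT A))[A1|AT].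
    have : [set p; q] \subset A by apply/subsetP=> z /set2P[]->.
    by move/subset_leq_card/leq_trans/(_ A1); rewrite cards2 pq.
  by rewrite AT inE in bA.
move=> mA; have [w [x [z [wA xA zA dxw dwz]]]] : exists w x z,
    [/\ w \notin A, x \in A, z \in A, before d x w & before d w z].
  move: mA; rewrite /module_of => /forall_inPn[w]; rewrite inE => /andP[wA _].
  case/forall_inPn=> x xA /forall_inPn[z zA] xz.
  have wn u : u \in A -> w != u by move=> uA; apply: contraNneq wA => ->.
  have sw u : u \in A -> (s w < s u) = true.
    by move: wA; rewrite !inE -leqNgt; apply: leq_ltn_trans.
  move: xz; rewrite /quadrant !sw // xpair_eqE eqxx andbT => xz.
  have [c|c] := boolP (before d x w).
    exists w, x, z; split=> //; have := before_total d (wn z zA).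
    case/orP=> // c'; move: c c' xz (wn z zA) (wn x xA); rewrite -!val_eqE /before /=.
    by clear; case: d; lia.
  exists w, z, x; split=> //; last first.
    by have := before_total d (wn x xA); rewrite (negPf c) orbF.
  have := before_total d (wn z zA); case/orP=> // c'.
  move: c c' xz (wn z zA) (wn x xA); rewrite -!val_eqE /before /=.
  by clear; case: d; lia.
have dwp : before d w p.
  apply: contraT => dwp; have wp : w != p by apply: contraNneq wA => ->.
  have := before_total d wp; rewrite (negPf dwp) /= => dpw.
  have := maxb _ (before_trans dpw dwz); rewrite /= leqNgt.
  by move: zA; rewrite inE => ->.
have wb : s w < s b.
  have : w != b by apply: contraTneq db => <-; rewrite (before_asym dwp).
  move=> /perm_val_neq swb; rewrite ltn_neqAle swb /=.
  by move: wA; rewrite inE -leqNgt.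
exists d, x, w, p, b; split; split=> //; first by move: xA; rewrite inE.
by apply: below; apply: contraTneq dxw => ->; rewrite (before_asym dwp).
Qed.

(** Length 4 is treated apart: the pattern found above is the whole permutation. *)
Lemma small_parallel_alternation : n = 4 -> horizontal_parallel_alternation s 2.
Proof.
move=> n4; have [d [x [y [p [b [[xy yp pb] [yb bx xp]]]]]]] := exists_zigzag4.
pose z i := nth x [:: x; y; p; b] i.
have order i j : i < j < n -> before d (z i) (z j).
  rewrite n4 /z; have xp' := before_trans xy yp; have yb' := before_trans yp pb.
  have xb' := before_trans xp' pb.
  by case: i => [|[|[|[|i]]]]; case: j => [|[|[|[|j]]]] //=; lia.
apply: (@zigzag_enum 2 n s z d true n4).
- move=> i j iN jN e; case: (ltngtP i j) => // ij.
    by have := order i j; rewrite ij jN e before_irr => /(_ isT).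
  by have := order j i; rewrite ij iN e before_irr => /(_ isT).
- by move=> i j /order; rewrite /before; clear; case: d; lia.
- move=> i j ij; have {ij} : i < j < 4 by lia.
  rewrite /z.
  by case: i => [|[|[|[|i]]]]; case: j => [|[|[|[|j]]]] //= ij; move: yb bx xp ij; clear; lia.
Qed.

End Pattern.
(** * The theorem of Schmerl and Trotter for permutations *)

Theorem mainTheorem1 (n : nat) (sigma : 'S_n) (n_ge1 : 1 <= n)
    (sigma_simple : simple_perm sigma)
    (sigma_not_pa : ~ parallel_alternation sigma) :
  exists x : 'I_n, simple_perm (perm_del sigma x).
Proof.
have [n2|n3] := leqP n 2.
  exists (Ordinal n_ge1) => A _; have : #|A| <= 1.
    by apply: leq_trans (max_card _) _; rewrite card_ord; lia.
  by case: #|A| => [|[|]] // _; [constructor 1|constructor 2].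
have /simple_permP sT := sigma_simple.
case: (boolP [exists x, simple_on (quadrant sigma) [set~ x]]) => [/existsP[x sx]|/existsPn crit].
  by exists x; apply: simple_perm_del.
case: sigma_not_pa.
have [d [x [y [p [b [ord val4]]]]]] := exists_zigzag4 sT n3.
have [sX cX] := zigzag4_simple ord val4.
have cT : #|'I_n| = n := card_ord n.
have := critical_even (@quadrantC n sigma) sT crit sX cX; rewrite cT => en.
have nm : n = 2 * n./2 by lia.
exists n./2; split=> //; first by lia.
have n4 : 4 <= n by lia.
have [n5|n5] := ltnP 4 n; last first.
  have e : n = 4 by lia.
  left; have -> : n./2 = 2 by rewrite e.
  exact: small_parallel_alternation sT n3 e.
have T5 : 4 < #|'I_n| by rewrite cT.
have [z [[c1 c2] [[e1 e2] [ec eic z_inj pat]]]] :=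
  critical_colors (@quadrantC n sigma) sT crit T5 sX cX.
rewrite cT in z_inj pat.
have posE i j : i < j < n -> (z i < z j) = if ~~ odd i && odd j then e1 else c1.
  by move=> /pat/(congr1 fst) /= ->; case: ifP.
have valE i j : i < j < n -> (sigma (z i) < sigma (z j)) = if ~~ odd i && odd j then e2 else c2.
  by move=> /pat/(congr1 snd) /= ->; case: ifP.
have [e1c1|e1c1] := eqVneq e1 c1.
  have e2c2 : e2 = ~~ c2.
    by move: ec; rewrite e1c1 xpair_eqE eqxx; case: (e2); case: (c2).
  left; apply: (@zigzag_enum _ _ _ z c1 c2) => // i j ij.
    by rewrite posE // e1c1; case: ifP.
  by rewrite valE // e2c2; case: (_ && _); rewrite ?addbT ?addbF.
right; apply: horizontal_vertical.
have e1c1' : e1 = ~~ c1 by move: e1c1; case: (e1); case: (c1).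
have e2c2 : e2 = c2.
  by move: eic; rewrite /opposite xpair_eqE e1c1' eqxx /=; case: (e2); case: (c2).
apply: (@zigzag_enum _ _ _ (fun i => sigma (z i)) c2 c1) => // i j.
- by move=> iN jN /perm_inj; apply: z_inj.
- by move=> ij; rewrite valE // e2c2; case: ifP.
- by move=> ij; rewrite !permK posE // e1c1'; case: (_ && _); rewrite ?addbT ?addbF.
Qed.
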